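(* Let $\mathcal{X}=(M\xrightarrow{\partial}N,\cdot,\{-,-\})$ be a perfect braided crossed module of Lie $K$-algebras (equivalently, such that the crossed module $(M\xrightarrow{\partial}N,\cdot)$ is perfect). Let $\Phi\colon\mathcal{U}\to\mathcal{X}$ be its universal central extension, where $\mathcal{U}=(N\otimes N\xrightarrow{\mathrm{Id}_{N\otimes N}}N\otimes N,[-,-],[-,-])$, $\Phi_1(n\otimes n')=\{n,n'\}$, $\Phi_2(n\otimes n')=[n,n']$, and let $c\colon\mathcal{V}\to\mathcal{X}$ be its universal compatible central extension, where $\mathcal{V}=(N\otimes M\xrightarrow{\mathrm{Id}_N\otimes\partial}N\otimes N,*,\langle\!\langle-,-\rangle\!\rangle)$, $c_1(n\otimes m)=n\cdot m$, $c_2(n\otimes n')=[n,n']$. Then there is a unique morphism of braided crossed modules $h\colon\mathcal{U}\to\mathcal{V}$ with $\Phi=c\circ h$, and $h$ is an isomorphism.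
   Context: $K$ is a fixed field; all Lie algebras and Lie homomorphisms are over $K$. A crossed module of Lie algebras $(M\xrightarrow{\partial}N,\cdot)$ consists of a Lie action of $N$ on $M$, i.e. a $K$-bilinear map $\cdot\colon N\times M\to M$ with $[n,n']\cdot m=n\cdot(n'\cdot m)-n'\cdot(n\cdot m)$ and $n\cdot[m,m']=[n\cdot m,m']+[m,n\cdot m']$, and a Lie homomorphism $\partial\colon M\to N$ with $\partial(n\cdot m)=[n,\partial(m)]$ and $\partial(m)\cdot m'=[m,m']$. A braiding on it is a $K$-bilinear map $\{-,-\}\colon N\times N\to M$ such that, for all $m,m'\in M$, $n,n',n''\in N$: $\partial\{n,n'\}=[n,n']$; $\{\partial m,\partial m'\}=[m,m']$; $\{\partial m,n\}=-n\cdot m$; $\{n,\partial m\}=n\cdot m$; $\{n,[n',n'']\}=\{[n,n'],n''\}-\{[n,n''],n'\}$; $\{[n,n'],n''\}=\{n,[n',n'']\}-\{n',[n,n'']\}$. A morphism of braided crossed modules from $(M\xrightarrow{\partial}N,\cdot,\{-,-\})$ to $(L\xrightarrow{\delta}H,*,\langle-,-\rangle)$ is a pair of Lie homomorphisms $f_1\colon M\to L$, $f_2\colon N\to H$ with $f_1(n\cdot m)=f_2(n)*f_1(m)$, $\delta\circ f_1=f_2\circ\partial$ and $f_1(\{n,n'\})=\langle f_2(n),f_2(n')\rangle$. Put $M^N=\{m\in M\mid n\cdot m=0\ \forall n\in N\}$, $\mathrm{st}_N(M)=\{n\in N\mid n\cdot m=0\ \forall m\in M\}$, $Z(N)$ the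 center of $N$, $Z_B(N)=\{n\in N\mid\{n,n'\}=0=\{n',n\}\ \forall n'\in N\}$. Let $B_N(M)$ (resp. $D_N(M)$) be the Lie subalgebra of $M$ generated by all $\{n,n'\}$ (resp. all $n\cdot m$). The braided crossed module is perfect if $M=B_N(M)$ and $N=[N,N]$; the crossed module $(M\xrightarrow{\partial}N,\cdot)$ is perfect if $M=D_N(M)$ and $N=[N,N]$. An extension of braided crossed modules is a morphism $(f_1,f_2)$ with $f_1,f_2$ surjective. With domain $(M\xrightarrow{\partial}N,\cdot,\{-,-\})$, it is central if $\ker(f_1)\subset M^N$ and $\ker(f_2)\subset Z_B(N)$, and it is a compatible central extension if $\ker(f_1)\subset M^N$ and $\ker(f_2)\subset\mathrm{st}_N(M)\cap Z(N)$. A (compatible) central extension $u\colon\mathcal{U}\to\mathcal{X}$ is universal if for every (compatible) central extension $f\colon\mathcal{Z}\to\mathcal{X}$ there is a unique morphism of braided crossed modules $h\colon\mathcal{U}\to\mathcal{Z}$ with $u=f\circ h$. Non-abelian tensor product: let $A,B$ be Lie algebras with $A$ acting on $B$ (written $a\cdot b$) and $B$ acting on $A$ (written $b\star a$). $A\otimes B$ is the Lie $K$-algebra generated by symbols $a\otimes b$ subject to: $K$-bilinearity of $(a,b)\mapsto a\otimes b$; $[a,a']\otimes b=a\otimes(a'\cdot b)-a'\otimes(a\cdot b)$; $a\otimes[b,b']=(b'\star a)\otimes b-(b\star a)\otimes b'$; $[a\otimes b,a'\otimes b']=-(b\star a)\otimes(a'\cdot b')$. $N\otimes N$ is formed with the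 adjoint actions of $N$ on itself. $N\otimes M$ is formed with the given action of $N$ on $M$ and the action $m\star n=[\partial(m),n]$ of $M$ on $N$. $\mathcal{U}$ is the identity of $N\otimes N$ with the adjoint action and braiding $(x,y)\mapsto[x,y]$. In $\mathcal{V}$: $(\mathrm{Id}_N\otimes\partial)(n\otimes m)=n\otimes\partial(m)$, $(n\otimes n')*(n''\otimes m)=[[n,n'],n'']\otimes m+n''\otimes([n,n']\cdot m)$, and $\langle\!\langle n\otimes n',n''\otimes n'''\rangle\!\rangle=[n,n']\otimes\{n'',n'''\}$ (extended $K$-bilinearly). *)

(* Defs.v *)
From HB Require Import structures.
From mathcomp Require Import all_boot all_order all_algebra generic_quotient.
From mathcomp Require Import boolp.

Set Implicit Arguments.
Unset Strict Implicit.
Unset Printing Implicit Defensive.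

Import GRing.Theory.
Local Open Scope ring_scope.
Local Open Scope quotient_scope.

Reserved Notation "⁅ x , y ⁆" (at level 0, x at level 200, y at level 200,
  format "⁅ x ,  y ⁆").

Definition bilin (K : fieldType) (U V W : lmodType K) (f : U -> V -> W) : Prop :=
  (forall v, linear (f^~ v)) /\ (forall u, linear (f u)).

HB.mixin Record Lmodule_isLie (K : fieldType) L of GRing.Lmodule K L := {
  lie : L -> L -> L;
  lie_bilin : bilin lie;
  lie_alt : forall x, lie x x = 0;
  lie_jacobi : forall x y z,
    lie x (lie y z) + lie y (lie z x) + lie z (lie x y) = 0
}.

#[short(type="lieAlgType")]
HB.structure Definition LieAlgebra (K : fieldType) :=
  {L of GRing.Lmodule K L & Lmodule_isLie K L}.

Notation "⁅ x , y ⁆" := (lie x y) : ring_scope.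

Section BilinTheory.
Variables (K : fieldType) (U V W : lmodType K) (f : U -> V -> W).
Hypothesis f_bilin : bilin f.

Lemma bilinDl u u' v : f (u + u') v = f u v + f u' v.
Proof. by have := f_bilin.1 v 1 u u'; rewrite !scale1r. Qed.

Lemma bilinDr u v v' : f u (v + v') = f u v + f u v'.
Proof. by have := f_bilin.2 u 1 v v'; rewrite !scale1r. Qed.

Lemma bilin0l v : f 0 v = 0.
Proof. by apply: (addrI (f 0 v)); rewrite -bilinDl !addr0. Qed.

Lemma bilin0r u : f u 0 = 0.
Proof. by apply: (addrI (f u 0)); rewrite -bilinDr !addr0. Qed.

Lemma bilinZl k u v : f (k *: u) v = k *: f u v.
Proof. by have := f_bilin.1 v k u 0; rewrite !addr0 bilin0l addr0. Qed.

Lemma bilinZr k u v : f u (k *: v) = k *: f u v.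
Proof. by have := f_bilin.2 u k v 0; rewrite !addr0 bilin0r addr0. Qed.

Lemma bilinNl u v : f (- u) v = - f u v.
Proof. by rewrite -scaleN1r bilinZl scaleN1r. Qed.

Lemma bilinNr u v : f u (- v) = - f u v.
Proof. by rewrite -scaleN1r bilinZr scaleN1r. Qed.

Lemma bilinBl u u' v : f (u - u') v = f u v - f u' v.
Proof. by rewrite bilinDl bilinNl. Qed.

Lemma bilinBr u v v' : f u (v - v') = f u v - f u v'.
Proof. by rewrite bilinDr bilinNr. Qed.

End BilinTheory.

Section LinTheory.
Variables (K : fieldType) (U V : lmodType K) (f : U -> V).
Hypothesis f_lin : linear f.

Lemma linD u v : f (u + v) = f u + f v.
Proof. by have := f_lin 1 u v; rewrite !scale1r. Qed.

Lemma lin0 : f 0 = 0.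
Proof. by apply: (addrI (f 0)); rewrite -linD !addr0. Qed.

Lemma linZ k u : f (k *: u) = k *: f u.
Proof. by have := f_lin k u 0; rewrite !addr0 lin0 addr0. Qed.

Lemma linN u : f (- u) = - f u.
Proof. by rewrite -scaleN1r linZ scaleN1r. Qed.

Lemma linB u v : f (u - v) = f u - f v.
Proof. by rewrite linD linN. Qed.

End LinTheory.

Lemma bilin_comp (K : fieldType) (U V W U' V' : lmodType K)
    (f : U -> V -> W) (g : U' -> U) (h : V' -> V) :
  bilin f -> linear g -> linear h -> bilin (fun x y => f (g x) (h y)).
Proof.
move=> fb gl hl; split=> [v|u] k x y /=.
  by rewrite gl (bilinDl fb) (bilinZl fb).
by rewrite hl (bilinDr fb) (bilinZr fb).
Qed.

Lemma linear_id (K : fieldType) (U : lmodType K) : linear (@id U).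
Proof. by []. Qed.

Section LieTheory.
Variables (K : fieldType) (L : lieAlgType K).
Implicit Types x y z : L.

Lemma lie_anti x y : ⁅x, y⁆ = - ⁅y, x⁆.
Proof.
apply/eqP; rewrite -addr_eq0; apply/eqP.
have := lie_alt (x + y).
rewrite (bilinDl lie_bilin) !(bilinDr lie_bilin) !lie_alt.
by rewrite addr0 add0r.
Qed.

Lemma lie_jacobil x y z : ⁅⁅x, y⁆, z⁆ = ⁅x, ⁅y, z⁆⁆ - ⁅y, ⁅x, z⁆⁆.
Proof.
rewrite (lie_anti x z) (bilinNr lie_bilin) opprK lie_anti.
by apply/esym/eqP; rewrite -subr_eq0 opprK lie_jacobi.
Qed.

Lemma lie_jacobir x y z : ⁅x, ⁅y, z⁆⁆ = ⁅⁅x, y⁆, z⁆ + ⁅y, ⁅x, z⁆⁆.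
Proof. by rewrite lie_jacobil subrK. Qed.

End LieTheory.

Definition lie_hom (K : fieldType) (L L' : lieAlgType K) (f : L -> L') : Prop :=
  linear f /\ {morph f : x y / ⁅x, y⁆ >-> ⁅x, y⁆}.

Lemma lie_hom_id (K : fieldType) (L : lieAlgType K) : lie_hom (@id L).
Proof. by []. Qed.

Lemma lie_hom_comp (K : fieldType) (L1 L2 L3 : lieAlgType K)
    (g : L2 -> L3) (f : L1 -> L2) :
  lie_hom g -> lie_hom f -> lie_hom (g \o f).
Proof.
move=> [gl gm] [fl fm]; split=> [k x y|x y] /=; first by rewrite fl gl.
by rewrite fm gm.
Qed.

Definition lie_subalgebra (K : fieldType) (L : lieAlgType K) (S : L -> Prop) :
    Prop :=
  [/\ S 0, forall (k : K) x y, S x -> S y -> S (k *: x + y)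
    & forall x y, S x -> S y -> S ⁅x, y⁆].

Definition lie_generated (K : fieldType) (L : lieAlgType K) (G : L -> Prop)
    (x : L) : Prop :=
  forall S : L -> Prop, lie_subalgebra S -> (forall y, G y -> S y) -> S x.

(* [L, L] is the linear span of the brackets. *)
Definition lie_derived (K : fieldType) (L : lieAlgType K) (x : L) : Prop :=
  forall S : L -> Prop, S 0 ->
  (forall (k : K) y z, S y -> S z -> S (k *: y + z)) ->
  (forall y z, S ⁅y, z⁆) -> S x.

Definition lie_center (K : fieldType) (L : lieAlgType K) (x : L) : Prop :=
  forall y, ⁅x, y⁆ = 0.

Record lieAction (K : fieldType) (A B : lieAlgType K) := LieAction {
  act :> A -> B -> B;
  act_bilin : bilin act;
  act_lie : forall a a' b, act ⁅a, a'⁆ b = act a (act a' b) - act a' (act a b);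
  act_der : forall a b b', act a ⁅b, b'⁆ = ⁅act a b, b'⁆ + ⁅b, act a b'⁆
}.

Definition adjoint (K : fieldType) (L : lieAlgType K) : lieAction L L :=
  LieAction (@lie_bilin K L) (@lie_jacobil K L) (@lie_jacobir K L).

Section Pullback.
Variables (K : fieldType) (A A' B : lieAlgType K) (alpha : lieAction A B).
Variables (f : A' -> A) (f_hom : lie_hom f).

Lemma pullback_bilin : bilin (fun a b => alpha (f a) b).
Proof.
exact: (bilin_comp (act_bilin alpha) f_hom.1 (@linear_id _ _)).
Qed.

Lemma pullback_lie a a' b :
  alpha (f ⁅a, a'⁆) b =
  alpha (f a) (alpha (f a') b) - alpha (f a') (alpha (f a) b).
Proof. by rewrite f_hom.2 act_lie. Qed.

Definition act_pullback : lieAction A' B :=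
  LieAction pullback_bilin pullback_lie (fun a => @act_der K A B alpha (f a)).

End Pullback.

Inductive tensor_term (K A B : Type) : Type :=
| TGen of A & B
| TZero
| TAdd of tensor_term K A B & tensor_term K A B
| TScale of K & tensor_term K A B
| TLie of tensor_term K A B & tensor_term K A B.
Arguments TGen {K A B}.
Arguments TZero {K A B}.

HB.instance Definition _ (K A B : Type) := gen_eqMixin (tensor_term K A B).
HB.instance Definition _ (K A B : Type) := gen_choiceMixin (tensor_term K A B).

Section Tensor.
Variables (K : fieldType) (A B : lieAlgType K).
Variables (alpha : lieAction A B) (beta : lieAction B A).

Local Notation term := (tensor_term K A B).

(* The least congruence making the terms a Lie algebra and imposing the
   defining relations of the tensor product. *)
Inductive tensor_cong : term -> term -> Prop :=
| tc_refl s : tensor_cong s s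
| tc_sym s t : tensor_cong s t -> tensor_cong t s
| tc_trans s t u : tensor_cong s t -> tensor_cong t u -> tensor_cong s u
| tc_add s s' t t' : tensor_cong s s' -> tensor_cong t t' ->
    tensor_cong (TAdd s t) (TAdd s' t')
| tc_scale k s s' : tensor_cong s s' -> tensor_cong (TScale k s) (TScale k s')
| tc_lie s s' t t' : tensor_cong s s' -> tensor_cong t t' ->
    tensor_cong (TLie s t) (TLie s' t')
| tc_addA s t u : tensor_cong (TAdd s (TAdd t u)) (TAdd (TAdd s t) u)
| tc_addC s t : tensor_cong (TAdd s t) (TAdd t s)
| tc_add0 s : tensor_cong (TAdd TZero s) s
| tc_addN s : tensor_cong (TAdd (TScale (-1) s) s) TZero
| tc_scaleA k l s : tensor_cong (TScale k (TScale l s)) (TScale (k * l) s)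
| tc_scale1 s : tensor_cong (TScale 1 s) s
| tc_scaleDr k s t :
    tensor_cong (TScale k (TAdd s t)) (TAdd (TScale k s) (TScale k t))
| tc_scaleDl k l s :
    tensor_cong (TScale (k + l) s) (TAdd (TScale k s) (TScale l s))
| tc_lie_linl k s t u :
    tensor_cong (TLie (TAdd (TScale k s) t) u)
                (TAdd (TScale k (TLie s u)) (TLie t u))
| tc_lie_linr k s t u :
    tensor_cong (TLie u (TAdd (TScale k s) t))
                (TAdd (TScale k (TLie u s)) (TLie u t))
| tc_lie_alt s : tensor_cong (TLie s s) TZero
| tc_lie_jacobi s t u :
    tensor_cong (TAdd (TAdd (TLie s (TLie t u)) (TLie t (TLie u s)))
                      (TLie u (TLie s t))) TZero
| tc_gen_linl k a a' b :
    tensor_cong (TGen (k *: a + a') b)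
                (TAdd (TScale k (TGen a b)) (TGen a' b))
| tc_gen_linr k a b b' :
    tensor_cong (TGen a (k *: b + b'))
                (TAdd (TScale k (TGen a b)) (TGen a b'))
| tc_gen_liel a a' b :
    tensor_cong (TGen ⁅a, a'⁆ b)
      (TAdd (TGen a (alpha a' b)) (TScale (-1) (TGen a' (alpha a b))))
| tc_gen_lier a b b' :
    tensor_cong (TGen a ⁅b, b'⁆)
      (TAdd (TGen (beta b' a) b) (TScale (-1) (TGen (beta b a) b')))
| tc_gen_lie a b a' b' :
    tensor_cong (TLie (TGen a b) (TGen a' b'))
      (TScale (-1) (TGen (beta b a) (alpha a' b'))).

Definition tensor_rel (s t : term) : bool := `[< tensor_cong s t >].

Lemma tensor_rel_refl : reflexive tensor_rel.
Proof. by move=> s; apply/asboolP; exact: tc_refl. Qed.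

Lemma tensor_rel_sym : symmetric tensor_rel.
Proof. by move=> s t; apply/asboolP/asboolP; exact: tc_sym. Qed.

Lemma tensor_rel_trans : transitive tensor_rel.
Proof.
by move=> t s u /asboolP st /asboolP tu; apply/asboolP; exact: tc_trans tu.
Qed.

Canonical tensor_equiv :=
  EquivRel tensor_rel tensor_rel_refl tensor_rel_sym tensor_rel_trans.

Definition tensor : Type := {eq_quot tensor_equiv}.
HB.instance Definition _ := Choice.on tensor.

Definition tclass (s : term) : tensor := \pi_({eq_quot tensor_equiv}) s.

Lemma tclassP s t : tclass s = tclass t <-> tensor_cong s t.
Proof.
split=> [/eqP|st]; first by rewrite /tclass eqmodE => /asboolP.
by apply/eqP; rewrite /tclass eqmodE; apply/asboolP.
Qed.

Lemma tclass_surj (x : tensor) : exists s, x = tclass s.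
Proof. by exists (repr x); rewrite /tclass reprK. Qed.

Lemma repr_tclass s : tensor_cong (repr (tclass s)) s.
Proof. by apply/tclassP; rewrite /tclass reprK. Qed.

Definition tensor_add (x y : tensor) : tensor := tclass (TAdd (repr x) (repr y)).
Definition tensor_scale (k : K) (x : tensor) : tensor :=
  tclass (TScale k (repr x)).
Definition tensor_lie (x y : tensor) : tensor := tclass (TLie (repr x) (repr y)).
Definition tensor_zero : tensor := tclass TZero.
Definition tensor_opp : tensor -> tensor := tensor_scale (-1).

Lemma tensor_addE s t : tensor_add (tclass s) (tclass t) = tclass (TAdd s t).
Proof. by apply/tclassP/tc_add; exact: repr_tclass. Qed.

Lemma tensor_scaleE k s : tensor_scale k (tclass s) = tclass (TScale k s).
Proof. by apply/tclassP/tc_scale; exact: repr_tclass. Qed.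

Lemma tensor_lieE s t : tensor_lie (tclass s) (tclass t) = tclass (TLie s t).
Proof. by apply/tclassP/tc_lie; exact: repr_tclass. Qed.

Lemma tensor_addA : associative tensor_add.
Proof.
move=> x y z; have [s ->] := tclass_surj x; have [t ->] := tclass_surj y.
have [u ->] := tclass_surj z.
by rewrite !tensor_addE; apply/tclassP; exact: tc_addA.
Qed.

Lemma tensor_addC : commutative tensor_add.
Proof.
move=> x y; have [s ->] := tclass_surj x; have [t ->] := tclass_surj y.
by rewrite !tensor_addE; apply/tclassP; exact: tc_addC.
Qed.

Lemma tensor_add0 : left_id tensor_zero tensor_add.
Proof.
move=> x; have [s ->] := tclass_surj x.
by rewrite tensor_addE; apply/tclassP; exact: tc_add0.
Qed.

Lemma tensor_addN : left_inverse tensor_zero tensor_opp tensor_add.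
Proof.
move=> x; have [s ->] := tclass_surj x.
by rewrite /tensor_opp tensor_scaleE tensor_addE; apply/tclassP; exact: tc_addN.
Qed.

HB.instance Definition _ :=
  GRing.isZmodule.Build tensor tensor_addA tensor_addC tensor_add0 tensor_addN.

Lemma tensor_scaleA k l x :
  tensor_scale k (tensor_scale l x) = tensor_scale (k * l) x.
Proof.
have [s ->] := tclass_surj x.
by rewrite !tensor_scaleE; apply/tclassP; exact: tc_scaleA.
Qed.

Lemma tensor_scale1 : left_id 1 tensor_scale.
Proof.
move=> x; have [s ->] := tclass_surj x.
by rewrite tensor_scaleE; apply/tclassP; exact: tc_scale1.
Qed.

Lemma tensor_scaleDr : right_distributive tensor_scale +%R.
Proof.
move=> k x y; have [s ->] := tclass_surj x; have [t ->] := tclass_surj y.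
rewrite /GRing.add /= !(tensor_scaleE, tensor_addE).
by apply/tclassP; exact: tc_scaleDr.
Qed.

Lemma tensor_scaleDl x : {morph tensor_scale^~ x : k l / k + l}.
Proof.
move=> k l; have [s ->] := tclass_surj x.
rewrite [RHS]/GRing.add /= !(tensor_scaleE, tensor_addE).
by apply/tclassP; exact: tc_scaleDl.
Qed.

HB.instance Definition _ := GRing.Zmodule_isLmodule.Build K tensor
  tensor_scaleA tensor_scale1 tensor_scaleDr tensor_scaleDl.

Lemma tclassD s t : tclass (TAdd s t) = tclass s + tclass t.
Proof. by rewrite -tensor_addE. Qed.

Lemma tclassZ k s : tclass (TScale k s) = k *: tclass s.
Proof. by rewrite -tensor_scaleE. Qed.

Lemma tensor_lie_bilin : bilin tensor_lie.
Proof.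
split=> x k y z; have [s ->] := tclass_surj x; have [t ->] := tclass_surj y;
  have [u ->] := tclass_surj z;
  rewrite -tclassZ -tclassD !tensor_lieE -tclassZ -tclassD; apply/tclassP.
  exact: tc_lie_linl.
exact: tc_lie_linr.
Qed.

Lemma tensor_lie_alt x : tensor_lie x x = 0.
Proof.
have [s ->] := tclass_surj x.
by rewrite tensor_lieE; apply/tclassP; exact: tc_lie_alt.
Qed.

Lemma tensor_lie_jacobi x y z :
  tensor_lie x (tensor_lie y z) + tensor_lie y (tensor_lie z x)
    + tensor_lie z (tensor_lie x y) = 0.
Proof.
have [s ->] := tclass_surj x; have [t ->] := tclass_surj y.
have [u ->] := tclass_surj z.
rewrite !tensor_lieE -!tclassD; apply/tclassP; exact: tc_lie_jacobi.
Qed.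

HB.instance Definition _ := Lmodule_isLie.Build K tensor
  tensor_lie_bilin tensor_lie_alt tensor_lie_jacobi.

Lemma tclass_lie s t : tclass (TLie s t) = ⁅tclass s, tclass t⁆.
Proof. by rewrite -tensor_lieE. Qed.

Definition tgen (a : A) (b : B) : tensor := tclass (TGen a b).

Lemma tgen_bilin : bilin tgen.
Proof.
split=> x k y z; rewrite /tgen -tclassZ -tclassD; apply/tclassP.
  exact: tc_gen_linl.
exact: tc_gen_linr.
Qed.

Lemma tgen_liel a a' b :
  tgen ⁅a, a'⁆ b = tgen a (alpha a' b) - tgen a' (alpha a b).
Proof.
rewrite -scaleN1r /tgen -tclassZ -tclassD; apply/tclassP; exact: tc_gen_liel.
Qed.

Lemma tgen_lier a b b' :
  tgen a ⁅b, b'⁆ = tgen (beta b' a) b - tgen (beta b a) b'.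
Proof.
rewrite -scaleN1r /tgen -tclassZ -tclassD; apply/tclassP; exact: tc_gen_lier.
Qed.

Lemma tgen_lie a b a' b' :
  ⁅tgen a b, tgen a' b'⁆ = - tgen (beta b a) (alpha a' b').
Proof.
rewrite -scaleN1r /tgen -tclassZ -tclass_lie; apply/tclassP; exact: tc_gen_lie.
Qed.

Lemma tensor_span (P : tensor -> Prop) :
  P 0 -> (forall (k : K) x y, P x -> P y -> P (k *: x + y)) ->
  (forall a b, P (tgen a b)) -> forall x, P x.
Proof.
move=> P0 PL PG.
pose span (x : tensor) := forall Q : tensor -> Prop, Q 0 ->
  (forall (k : K) x y, Q x -> Q y -> Q (k *: x + y)) ->
  (forall a b, Q (tgen a b)) -> Q x.
suff all_span x : span x by move=> x; exact: (all_span x P P0 PL PG).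
have span0 : span 0 by [].
have spanL k y z : span y -> span z -> span (k *: y + z).
  by move=> sy sz Q Q0 QL QG; apply: (QL k); [exact: sy | exact: sz].
have spanG a b : span (tgen a b) by move=> Q _ _ QG; exact: QG.
have spanD y z : span y -> span z -> span (y + z).
  by move=> sy sz; rewrite -[y]scale1r; exact: spanL.
have spanZ k y : span y -> span (k *: y).
  by move=> sy; rewrite -[_ *: _]addr0; exact: spanL.
have spanGl a b y : span y -> span ⁅tgen a b, y⁆.
  move/(_ (fun y => span ⁅tgen a b, y⁆)); apply=> [|k u v su sv|a' b'].
  - by rewrite (bilin0r lie_bilin).
  - by rewrite (bilinDr lie_bilin) (bilinZr lie_bilin); exact: spanL.
  by rewrite tgen_lie -scaleN1r; exact: spanZ.
have [s ->] := tclass_surj x; elim: s => [a b||s IHs t IHt|k s IHs|s IHs t IHt].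
- exact: spanG.
- exact: span0.
- by rewrite tclassD; exact: spanD.
- by rewrite tclassZ; exact: spanZ.
rewrite tclass_lie; apply: (IHs (fun y => span ⁅y, tclass t⁆)) => [|k u v su sv|a b].
- by rewrite (bilin0l lie_bilin).
- by rewrite (bilinDl lie_bilin) (bilinZl lie_bilin); exact: spanL.
exact: spanGl.
Qed.

Section Lift.
Variables (L : lieAlgType K) (g : A -> B -> L).

Record tensor_compat : Prop := TensorCompat {
  tcompat_bilin : bilin g;
  tcompat_liel : forall a a' b,
    g ⁅a, a'⁆ b = g a (alpha a' b) - g a' (alpha a b);
  tcompat_lier : forall a b b',
    g a ⁅b, b'⁆ = g (beta b' a) b - g (beta b a) b';
  tcompat_lie : forall a b a' b',
    ⁅g a b, g a' b'⁆ = - g (beta b a) (alpha a' b')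
}.

Fixpoint tensor_eval (s : term) : L :=
  match s with
  | TGen a b => g a b
  | TZero => 0
  | TAdd s t => tensor_eval s + tensor_eval t
  | TScale k s => k *: tensor_eval s
  | TLie s t => ⁅tensor_eval s, tensor_eval t⁆
  end.

Definition tensor_lift (x : tensor) : L := tensor_eval (repr x).

Hypothesis g_compat : tensor_compat.

Lemma tensor_eval_cong s t : tensor_cong s t -> tensor_eval s = tensor_eval t.
Proof.
have [gb gl gr gg] := g_compat.
elim=> //= {s t}.
- by move=> s t u _ -> _ ->.
- by move=> s s' t t' _ -> _ ->.
- by move=> k s s' _ ->.
- by move=> s s' t t' _ -> _ ->.
- by move=> s t u; rewrite addrA.
- by move=> s t; rewrite addrC.
- by move=> s; rewrite add0r.
- by move=> s; rewrite scaleN1r addNr.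
- by move=> k l s; rewrite scalerA.
- by move=> s; rewrite scale1r.
- by move=> k s t; rewrite scalerDr.
- by move=> k l s; rewrite scalerDl.
- by move=> k s t u; rewrite (bilinDl lie_bilin) (bilinZl lie_bilin).
- by move=> k s t u; rewrite (bilinDr lie_bilin) (bilinZr lie_bilin).
- by move=> s; rewrite lie_alt.
- by move=> s t u; rewrite lie_jacobi.
- by move=> k a a' b; rewrite (bilinDl gb) (bilinZl gb).
- by move=> k a b b'; rewrite (bilinDr gb) (bilinZr gb).
- by move=> a a' b; rewrite gl scaleN1r.
- by move=> a b b'; rewrite gr scaleN1r.
by move=> a b a' b'; rewrite gg scaleN1r.
Qed.

Lemma tensor_lift_class s : tensor_lift (tclass s) = tensor_eval s.
Proof. by apply: tensor_eval_cong; exact: repr_tclass. Qed.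

Lemma tensor_lift_hom : lie_hom tensor_lift.
Proof.
split=> [k x y|x y]; have [s ->] := tclass_surj x; have [t ->] := tclass_surj y.
  by rewrite -tclassZ -tclassD !tensor_lift_class.
by rewrite -tclass_lie !tensor_lift_class.
Qed.

Lemma tensor_lift_gen a b : tensor_lift (tgen a b) = g a b.
Proof. exact: tensor_lift_class. Qed.

End Lift.

Lemma tensor_ext (V : lmodType K) (f g : tensor -> V) :
  linear f -> linear g -> (forall a b, f (tgen a b) = g (tgen a b)) -> f =1 g.
Proof.
move=> fl gl fg; apply: tensor_span => [|k x y fx fy|//].
  by rewrite !lin0.
by rewrite fl gl fx fy.
Qed.

End Tensor.

Record crossedModule (K : fieldType) := CrossedModule {
  xtop : lieAlgType K;
  xbase : lieAlgType K;
  xact : lieAction xbase xtop;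
  xbd : xtop -> xbase;
  xbd_hom : lie_hom xbd;
  xbd_act : forall n m, xbd (xact n m) = ⁅n, xbd m⁆;
  xpeiffer : forall m m', xact (xbd m) m' = ⁅m, m'⁆
}.

Record braiding (K : fieldType) (X : crossedModule K) := Braiding {
  br :> xbase X -> xbase X -> xtop X;
  br_bilin : bilin br;
  br_bd : forall n n', xbd (br n n') = ⁅n, n'⁆;
  br_bdbd : forall m m', br (xbd m) (xbd m') = ⁅m, m'⁆;
  br_bdl : forall m n, br (xbd m) n = - xact X n m;
  br_bdr : forall n m, br n (xbd m) = xact X n m;
  br_lier : forall n n' n'', br n ⁅n', n''⁆ = br ⁅n, n'⁆ n'' - br ⁅n, n''⁆ n';
  br_liel : forall n n' n'', br ⁅n, n'⁆ n'' = br n ⁅n', n''⁆ - br n' ⁅n, n''⁆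
}.

Record braidedCrossedModule (K : fieldType) := BraidedCrossedModule {
  bxm_xm :> crossedModule K;
  xbr : braiding bxm_xm
}.

Record bxmHom (K : fieldType) (X Y : braidedCrossedModule K) := BxmHom {
  hom1 : xtop X -> xtop Y;
  hom2 : xbase X -> xbase Y;
  hom1_lie : lie_hom hom1;
  hom2_lie : lie_hom hom2;
  hom_act : forall n m, hom1 (xact X n m) = xact Y (hom2 n) (hom1 m);
  hom_bd : forall m, xbd (hom1 m) = hom2 (xbd m);
  hom_br : forall n n', hom1 (xbr X n n') = xbr Y (hom2 n) (hom2 n')
}.

Lemma bxmHom_ext (K : fieldType) (X Y : braidedCrossedModule K)
    (f g : bxmHom X Y) : hom1 f =1 hom1 g -> hom2 f =1 hom2 g -> f = g.
Proof.
move=> /funext e1 /funext e2.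
case: f g e1 e2 => f1 f2 a b c d e [g1 g2 a' b' c' d' e'] /= e1 e2.
by subst g1 g2; congr BxmHom; exact: Prop_irrelevance.
Qed.

Definition bxm_id (K : fieldType) (X : braidedCrossedModule K) : bxmHom X X :=
  @BxmHom K X X id id (lie_hom_id _) (lie_hom_id _) (fun _ _ => erefl)
    (fun _ => erefl) (fun _ _ => erefl).

Section Comp.
Variables (K : fieldType) (X Y Z : braidedCrossedModule K).
Variables (g : bxmHom Y Z) (f : bxmHom X Y).

Lemma comp_act n m :
  (hom1 g \o hom1 f) (xact X n m) =
  xact Z ((hom2 g \o hom2 f) n) ((hom1 g \o hom1 f) m).
Proof. by rewrite /= !hom_act. Qed.

Lemma comp_bd m : xbd ((hom1 g \o hom1 f) m) = (hom2 g \o hom2 f) (xbd m).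
Proof. by rewrite /= !hom_bd. Qed.

Lemma comp_br n n' :
  (hom1 g \o hom1 f) (xbr X n n') =
  xbr Z ((hom2 g \o hom2 f) n) ((hom2 g \o hom2 f) n').
Proof. by rewrite /= !hom_br. Qed.

Definition bxm_comp : bxmHom X Z :=
  BxmHom (lie_hom_comp (hom1_lie g) (hom1_lie f))
    (lie_hom_comp (hom2_lie g) (hom2_lie f)) comp_act comp_bd comp_br.

End Comp.

Definition bxm_iso (K : fieldType) (X Y : braidedCrossedModule K)
    (f : bxmHom X Y) : Prop :=
  exists g : bxmHom Y X, bxm_comp g f = bxm_id X /\ bxm_comp f g = bxm_id Y.

Section Notions.
Variables (K : fieldType) (X : braidedCrossedModule K).

Definition xinvariant (m : xtop X) : Prop := forall n, xact X n m = 0.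

Definition xstabilizer (n : xbase X) : Prop := forall m, xact X n m = 0.

Definition xbr_center (n : xbase X) : Prop :=
  forall n', xbr X n n' = 0 /\ xbr X n' n = 0.

Definition bxm_perfect : Prop :=
  (forall m : xtop X, lie_generated (fun y => exists n n', y = xbr X n n') m) /\
  (forall n : xbase X, lie_derived n).

End Notions.

Section Extensions.
Variables (K : fieldType) (Z X : braidedCrossedModule K) (f : bxmHom Z X).

Definition extension : Prop :=
  (forall m, exists z, hom1 f z = m) /\ (forall n, exists z, hom2 f z = n).

Definition central_extension : Prop :=
  [/\ extension, forall m, hom1 f m = 0 -> xinvariant m
    & forall n, hom2 f n = 0 -> xbr_center n].

Definition compatible_central_extension : Prop :=
  [/\ extension, forall m, hom1 f m = 0 -> xinvariant m
    & forall n, hom2 f n = 0 -> xstabilizer n /\ lie_center n].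

End Extensions.

Definition universal_central_extension (K : fieldType)
    (U X : braidedCrossedModule K) (u : bxmHom U X) : Prop :=
  central_extension u /\
  forall (Z : braidedCrossedModule K) (f : bxmHom Z X), central_extension f ->
    exists! h : bxmHom U Z, u = bxm_comp f h.

Definition universal_compatible_central_extension (K : fieldType)
    (U X : braidedCrossedModule K) (u : bxmHom U X) : Prop :=
  compatible_central_extension u /\
  forall (Z : braidedCrossedModule K) (f : bxmHom Z X),
    compatible_central_extension f ->
    exists! h : bxmHom U Z, u = bxm_comp f h.

(* The identity of L as a braided crossed module, with action and braiding both
   given by the bracket. *)
Section Identity.
Variables (K : fieldType) (L : lieAlgType K).

Definition id_xm : crossedModule K :=
  @CrossedModule K L L (adjoint L) id (lie_hom_id L) (fun _ _ => erefl)
    (fun _ _ => erefl).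

Lemma lie_jacobi_br (x y z : L) : ⁅x, ⁅y, z⁆⁆ = ⁅⁅x, y⁆, z⁆ - ⁅⁅x, z⁆, y⁆.
Proof. by rewrite lie_jacobir (lie_anti y). Qed.

Definition id_br : braiding id_xm :=
  @Braiding K id_xm (@lie K L) (@lie_bilin K L) (fun _ _ => erefl)
    (fun _ _ => erefl) (@lie_anti K L) (fun _ _ => erefl) lie_jacobi_br
    (@lie_jacobil K L).

Definition id_bxm : braidedCrossedModule K := BraidedCrossedModule id_br.

End Identity.

Section UniversalExtensions.
Variables (K : fieldType) (X : braidedCrossedModule K).

Local Notation M := (xtop X).
Local Notation N := (xbase X).
Local Notation "n · m" := (xact X n m) (at level 40, left associativity).
Local Notation "∂ m" := (@xbd K X m) (at level 9, m at level 9).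
Local Notation "'{{' x , y '}}'" := (br (xbr X) x y).

Definition tensNN : lieAlgType K := tensor (adjoint N) (adjoint N).

(* The action of M on N is m ⋆ n = [∂ m, n]. *)
Definition tensNM : lieAlgType K :=
  tensor (xact X) (act_pullback (adjoint N) (xbd_hom X)).

Definition gNN (n n' : N) : tensNN := tgen (adjoint N) (adjoint N) n n'.
Definition gNM (n : N) (m : M) : tensNM :=
  tgen (xact X) (act_pullback (adjoint N) (xbd_hom X)) n m.

Local Notation "n ⊗ n'" := (gNN n n') (at level 40).
Local Notation "n ⊗' m" := (gNM n m) (at level 40).

Lemma gNN_bilin : bilin gNN. Proof. exact: tgen_bilin. Qed.
Lemma gNM_bilin : bilin gNM. Proof. exact: tgen_bilin. Qed.

Lemma gNN_lie a b a' b' : ⁅a ⊗ b, a' ⊗ b'⁆ = ⁅a, b⁆ ⊗ ⁅a', b'⁆.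
Proof. by rewrite (lie_anti a b) (bilinNl gNN_bilin); exact: tgen_lie. Qed.

Lemma gNM_lie a m a' m' : ⁅a ⊗' m, a' ⊗' m'⁆ = ⁅a, ∂ m⁆ ⊗' (a' · m').
Proof. by rewrite (lie_anti a) (bilinNl gNM_bilin); exact: tgen_lie. Qed.

Lemma gNM_liel a a' m : ⁅a, a'⁆ ⊗' m = a ⊗' (a' · m) - a' ⊗' (a · m).
Proof. exact: tgen_liel. Qed.

Lemma gNM_lier a m m' : a ⊗' ⁅m, m'⁆ = ⁅∂ m', a⁆ ⊗' m - ⁅∂ m, a⁆ ⊗' m'.
Proof. exact: tgen_lier. Qed.

Lemma xbr_tensor_compat : tensor_compat (adjoint N) (adjoint N) (br (xbr X)).
Proof.
split=> [|a a' b|a b b'|a b a' b'] /=.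
- exact: br_bilin.
- exact: br_liel.
- rewrite br_lier (lie_anti a b) (lie_anti a b') !(bilinNl (br_bilin _)).
  by rewrite opprK addrC.
by rewrite -(br_bdbd (xbr X)) !br_bd (lie_anti b a) (bilinNl (br_bilin _)) opprK.
Qed.

Lemma lie_tensor_compat : tensor_compat (adjoint N) (adjoint N) (@lie K N).
Proof.
split=> [|a a' b|a b b'|a b a' b'] /=.
- exact: lie_bilin.
- exact: lie_jacobil.
- rewrite lie_jacobir (lie_anti a b) (lie_anti b' a) (lie_anti b ⁅a, b'⁆).
  by rewrite !(bilinNl lie_bilin) addrC.
by rewrite (lie_anti b a) (bilinNl lie_bilin) opprK.
Qed.

Lemma act_tensor_compat :
  tensor_compat (xact X) (act_pullback (adjoint N) (xbd_hom X)) (xact X).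
Proof.
split=> [|a a' b|a b b'|a b a' b'] /=.
- exact: act_bilin.
- exact: act_lie.
- rewrite act_der (lie_anti (∂ b') a) (lie_anti (∂ b) a).
  rewrite !(bilinNl (act_bilin _)) -!xbd_act !xpeiffer opprK.
  by rewrite (lie_anti b) addrC.
rewrite -xpeiffer xbd_act (lie_anti a) (bilinNl (act_bilin _)) //.
Qed.

Lemma gNbd_tensor_compat :
  tensor_compat (xact X) (act_pullback (adjoint N) (xbd_hom X))
    (fun n m => n ⊗ ∂ m).
Proof.
split=> [|a a' b|a b b'|a b a' b'] /=.
- exact: (bilin_comp gNN_bilin (@linear_id _ _) (xbd_hom X).1).
- by rewrite !xbd_act; exact: tgen_liel.
- by rewrite (xbd_hom X).2; exact: tgen_lier.
by rewrite xbd_act; exact: tgen_lie.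
Qed.

(* n ⊗ n' |-> {n, n'} *)
Definition Phi1 : tensNN -> M := tensor_lift (br (xbr X)).
(* n ⊗ n' |-> [n, n'] *)
Definition lieNN : tensNN -> N := tensor_lift (@lie K N).
(* n ⊗ m |-> n · m *)
Definition c1 : tensNM -> M := tensor_lift (xact X).
(* n ⊗ m |-> n ⊗ ∂ m *)
Definition id_tens_bd : tensNM -> tensNN := tensor_lift (fun n m => n ⊗ ∂ m).

Lemma Phi1_gen n n' : Phi1 (n ⊗ n') = {{n, n'}}.
Proof. exact: (tensor_lift_gen xbr_tensor_compat). Qed.

Lemma lieNN_gen n n' : lieNN (n ⊗ n') = ⁅n, n'⁆.
Proof. exact: (tensor_lift_gen lie_tensor_compat). Qed.

Lemma c1_gen n m : c1 (n ⊗' m) = n · m.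
Proof. exact: (tensor_lift_gen act_tensor_compat). Qed.

Lemma id_tens_bd_gen n m : id_tens_bd (n ⊗' m) = n ⊗ ∂ m.
Proof. exact: (tensor_lift_gen gNbd_tensor_compat). Qed.

Lemma Phi1_hom : lie_hom Phi1.
Proof. exact: (tensor_lift_hom xbr_tensor_compat). Qed.

Lemma lieNN_hom : lie_hom lieNN.
Proof. exact: (tensor_lift_hom lie_tensor_compat). Qed.

Lemma c1_hom : lie_hom c1.
Proof. exact: (tensor_lift_hom act_tensor_compat). Qed.

Lemma id_tens_bd_hom : lie_hom id_tens_bd.
Proof. exact: (tensor_lift_hom gNbd_tensor_compat). Qed.

Lemma linear_comp (U V W : lmodType K) (g : V -> W) (f : U -> V) :
  linear g -> linear f -> linear (fun x => g (f x)).
Proof. by move=> gl fl k x y /=; rewrite fl gl. Qed.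

Lemma tensNN_lie (x y : tensNN) : ⁅x, y⁆ = lieNN x ⊗ lieNN y.
Proof.
have cb := bilin_comp gNN_bilin lieNN_hom.1 lieNN_hom.1.
apply: (tensor_ext (lie_bilin.1 y) (cb.1 y)) => a b /=.
apply: (tensor_ext (lie_bilin.2 _) (cb.2 _)) => a' b' /=.
by rewrite !lieNN_gen; exact: gNN_lie.
Qed.

Lemma tensNM_lie (x y : tensNM) : ⁅x, y⁆ = ∂ (c1 x) ⊗' c1 y.
Proof.
have cb := bilin_comp gNM_bilin (linear_comp (xbd_hom X).1 c1_hom.1) c1_hom.1.
apply: (tensor_ext (lie_bilin.1 y) (cb.1 y)) => a b /=.
apply: (tensor_ext (lie_bilin.2 _) (cb.2 _)) => a' b' /=.
by rewrite !c1_gen xbd_act; exact: gNM_lie.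
Qed.

Lemma xbd_Phi1 x : ∂ (Phi1 x) = lieNN x.
Proof.
apply: (tensor_ext (linear_comp (xbd_hom X).1 Phi1_hom.1) lieNN_hom.1) => a b.
by rewrite Phi1_gen lieNN_gen br_bd.
Qed.

Lemma Phi1_id_tens_bd y : Phi1 (id_tens_bd y) = c1 y.
Proof.
apply: (tensor_ext (linear_comp Phi1_hom.1 id_tens_bd_hom.1) c1_hom.1) => a b.
by rewrite id_tens_bd_gen Phi1_gen c1_gen br_bdr.
Qed.

Lemma lieNN_id_tens_bd y : lieNN (id_tens_bd y) = ∂ (c1 y).
Proof. by rewrite -xbd_Phi1 Phi1_id_tens_bd. Qed.

(* The action of N ⊗ N on N ⊗ M in closed form; [V_act_gen] gives its value on
   generators, which determines it by bilinearity. *)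
Definition V_act_fun (x : tensNN) (y : tensNM) : tensNM := lieNN x ⊗' c1 y.

Lemma V_act_gen n n' n'' m :
  V_act_fun (n ⊗ n') (n'' ⊗' m) =
  ⁅⁅n, n'⁆, n''⁆ ⊗' m + n'' ⊗' (⁅n, n'⁆ · m).
Proof. by rewrite /V_act_fun lieNN_gen c1_gen (gNM_liel ⁅n, n'⁆) subrK. Qed.

(* Closed form again; see [V_br_gen]. *)
Definition V_br_fun (x y : tensNN) : tensNM := lieNN x ⊗' Phi1 y.

Lemma V_br_gen n1 n2 n3 n4 :
  V_br_fun (n1 ⊗ n2) (n3 ⊗ n4) = ⁅n1, n2⁆ ⊗' {{n3, n4}}.
Proof. by rewrite /V_br_fun lieNN_gen Phi1_gen. Qed.

Lemma c1_V_act x y : c1 (V_act_fun x y) = lieNN x · c1 y.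
Proof. exact: c1_gen. Qed.

Lemma V_act_bilin : bilin V_act_fun.
Proof. exact: (bilin_comp gNM_bilin lieNN_hom.1 c1_hom.1). Qed.

Lemma V_act_lie x x' y :
  V_act_fun ⁅x, x'⁆ y =
  V_act_fun x (V_act_fun x' y) - V_act_fun x' (V_act_fun x y).
Proof. by rewrite /V_act_fun !c1_gen lieNN_hom.2 gNM_liel. Qed.

Lemma V_act_der x y y' :
  V_act_fun x ⁅y, y'⁆ = ⁅V_act_fun x y, y'⁆ + ⁅y, V_act_fun x y'⁆.
Proof.
rewrite [⁅y, V_act_fun x y'⁆]lie_anti [LHS]/V_act_fun c1_hom.2 gNM_lier.
rewrite !tensNM_lie !c1_V_act !xbd_act (lie_anti (∂ (c1 y'))).
by rewrite (lie_anti (∂ (c1 y))) !(bilinNl gNM_bilin) opprK addrC.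
Qed.

Definition V_act : lieAction tensNN tensNM :=
  LieAction V_act_bilin V_act_lie V_act_der.

Lemma V_bd_act x y : id_tens_bd (V_act x y) = ⁅x, id_tens_bd y⁆.
Proof.
by rewrite /= /V_act_fun id_tens_bd_gen tensNN_lie lieNN_id_tens_bd.
Qed.

Lemma V_peiffer y y' : V_act (id_tens_bd y) y' = ⁅y, y'⁆.
Proof. by rewrite /= /V_act_fun lieNN_id_tens_bd tensNM_lie. Qed.

Definition V_xm : crossedModule K :=
  CrossedModule id_tens_bd_hom V_bd_act V_peiffer.

Lemma V_br_bilin : bilin V_br_fun.
Proof. exact: (bilin_comp gNM_bilin lieNN_hom.1 Phi1_hom.1). Qed.

Lemma V_br_bd x y : id_tens_bd (V_br_fun x y) = ⁅x, y⁆.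
Proof. by rewrite /V_br_fun id_tens_bd_gen xbd_Phi1 tensNN_lie. Qed.

Lemma V_br_bdr x y : V_br_fun x (id_tens_bd y) = V_act x y.
Proof. by rewrite /V_br_fun Phi1_id_tens_bd. Qed.

Lemma V_br_bdbd y y' : V_br_fun (id_tens_bd y) (id_tens_bd y') = ⁅y, y'⁆.
Proof. by rewrite V_br_bdr V_peiffer. Qed.

Lemma V_br_bdl y x : V_br_fun (id_tens_bd y) x = - V_act x y.
Proof.
have linl := linear_comp (V_br_bilin.1 x) id_tens_bd_hom.1.
have linr : linear (fun y => - V_act x y).
  by move=> k u v; rewrite (act_bilin V_act).2 opprD scalerN.
apply: (tensor_ext linl linr) => a m /=.
rewrite /V_br_fun /V_act_fun lieNN_id_tens_bd c1_gen xbd_act -xbd_Phi1.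
have := gNM_liel (∂ (Phi1 x)) a m; rewrite xpeiffer => /eqP.
rewrite eq_sym subr_eq => /eqP ->.
rewrite (lie_anti (Phi1 x)) (bilinNr gNM_bilin) gNM_lier.
by rewrite subKr (lie_anti a) (bilinNl gNM_bilin).
Qed.

Lemma V_br_lier x y z :
  V_br_fun x ⁅y, z⁆ = V_br_fun ⁅x, y⁆ z - V_br_fun ⁅x, z⁆ y.
Proof.
rewrite /V_br_fun Phi1_hom.2 gNM_lier !xbd_Phi1 !lieNN_hom.2.
rewrite (lie_anti (lieNN z)) (lie_anti (lieNN y)).
by rewrite !(bilinNl gNM_bilin) opprK addrC.
Qed.

Lemma Phi1_lie x y : Phi1 ⁅x, y⁆ = lieNN x · Phi1 y.
Proof. by rewrite Phi1_hom.2 -xpeiffer xbd_Phi1. Qed.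

Lemma V_br_liel x y z :
  V_br_fun ⁅x, y⁆ z = V_br_fun x ⁅y, z⁆ - V_br_fun y ⁅x, z⁆.
Proof. by rewrite /V_br_fun !Phi1_lie lieNN_hom.2 gNM_liel. Qed.

Definition V_br : braiding V_xm :=
  @Braiding K V_xm V_br_fun V_br_bilin V_br_bd V_br_bdbd V_br_bdl V_br_bdr
    V_br_lier V_br_liel.

Definition Vbxm : braidedCrossedModule K := BraidedCrossedModule V_br.

Lemma Phi1_br x y : Phi1 ⁅x, y⁆ = {{lieNN x, lieNN y}}.
Proof. by rewrite Phi1_hom.2 -(br_bdbd (xbr X)) !xbd_Phi1. Qed.

Lemma c1_br x y : c1 (V_br_fun x y) = {{lieNN x, lieNN y}}.
Proof. by rewrite /V_br_fun c1_gen -(br_bdr (xbr X)) xbd_Phi1. Qed.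

Definition Ubxm : braidedCrossedModule K := id_bxm tensNN.

Definition Phi : bxmHom Ubxm X :=
  @BxmHom K Ubxm X Phi1 lieNN Phi1_hom lieNN_hom Phi1_lie xbd_Phi1 Phi1_br.

Lemma lieNN_V_bd y : ∂ (c1 y) = lieNN (id_tens_bd y).
Proof. by rewrite lieNN_id_tens_bd. Qed.

Definition cV : bxmHom Vbxm X :=
  @BxmHom K Vbxm X c1 lieNN c1_hom lieNN_hom c1_V_act lieNN_V_bd c1_br.

End UniversalExtensions.

(* Main.v *)
Require Import Defs.
From mathcomp Require Import all_boot all_order all_algebra.
From mathcomp Require Import boolp.

(** In a central extension of X the bracket and the braiding of two elements
    of the base, and in a compatible one the action of a base element on a top
    element, depend only on their images in X.  They hence factor through the
    tensor products over X, which gives the comparison morphisms out of U and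
    V; these are unique because the generators of the tensor products are
    brackets or values of the action.  For the last claim, perfectness makes
    [∂] surjective, so [n ⊗ m] vanishes as soon as [∂ m = 0]; therefore U and V
    are both central and compatible central extensions of X, and each has the
    universal property of the other. *)

Set Implicit Arguments.
Unset Strict Implicit.
Unset Printing Implicit Defensive.

Import GRing.Theory.
Local Open Scope ring_scope.

Definition surj (U V : Type) (f : U -> V) : Prop := forall v, exists u, f u = v.

Lemma bilin_factor (K : fieldType) (U U' V V' W : lmodType K)
    (p : U -> U') (r : V -> V') (b : U -> V -> W) :
  linear p -> linear r -> surj p -> surj r -> bilin b ->
  (forall u v, p u = 0 -> b u v = 0) -> (forall u v, r v = 0 -> b u v = 0) ->
  exists2 g : U' -> V' -> W, bilin g & forall u v, g (p u) (r v) = b u v.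
Proof.
move=> pl rl ps rs bb b0l b0r.
have [s sK] := choice ps; have [t tK] := choice rs.
have gE u v : b (s (p u)) (t (r v)) = b u v.
  apply/eqP; rewrite -subr_eq0 -[X in X - _](subrK (b u (t (r v)))).
  rewrite -(bilinBl bb) -addrA -(bilinBr bb)
    b0l; last by rewrite (linB pl) sK subrr.
  by rewrite b0r ?add0r// (linB rl) tK subrr.
exists (fun u' v' => b (s u') (t v')) => //.
split=> [v'|u'] k x y.
  have [u <-] := ps x; have [u' <-] := ps y; have [v <-] := rs v'.
  by rewrite -pl !gE (bilinDl bb) (bilinZl bb).
have [v <-] := rs x; have [v' <-] := rs y; have [u <-] := ps u'.
by rewrite -rl !gE (bilinDr bb) (bilinZr bb).
Qed.

Lemma tensor_factor (K : fieldType) (A A' B B' L : lieAlgType K)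
    (alpha : lieAction A B) (beta : lieAction B A)
    (alpha' : lieAction A' B') (beta' : lieAction B' A')
    (p : A' -> A) (r : B' -> B) (b : A' -> B' -> L) :
  tensor_compat alpha' beta' b ->
  lie_hom p -> lie_hom r -> surj p -> surj r ->
  (forall x y, r (alpha' x y) = alpha (p x) (r y)) ->
  (forall x y, p (beta' y x) = beta (r y) (p x)) ->
  (forall x y, p x = 0 -> b x y = 0) -> (forall x y, r y = 0 -> b x y = 0) ->
  exists2 h : tensor alpha beta -> L, lie_hom h &
    forall x y, h (tgen alpha beta (p x) (r y)) = b x y.
Proof.
move=> [bb bl br bg] [pl pm] [rl rm] ps rs ra pb b0l b0r.
have [g gb gE] := bilin_factor pl rl ps rs bb b0l b0r.
have gc : tensor_compat alpha beta g.
  split=> [//|x x' y|x y y'|x y x' y'].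
  - have [u <-] := ps x; have [u' <-] := ps x'; have [v <-] := rs y.
    by rewrite -pm -!ra !gE.
  - have [u <-] := ps x; have [v <-] := rs y; have [v' <-] := rs y'.
    by rewrite -rm -!pb !gE.
  have [u <-] := ps x; have [u' <-] := ps x'.
  have [v <-] := rs y; have [v' <-] := rs y'.
  by rewrite -ra -pb !gE.
exists (tensor_lift g); first exact: tensor_lift_hom.
by move=> x y; rewrite tensor_lift_gen.
Qed.

Lemma lie_hom_image_subalgebra (K : fieldType) (L L' : lieAlgType K)
    (f : L -> L') : lie_hom f -> lie_subalgebra (fun y => exists x, f x = y).
Proof.
move=> [fl fm]; split; first by exists 0; rewrite (lin0 fl).
  by move=> k _ _ [x <-] [y <-]; exists (k *: x + y); rewrite fl.
by move=> _ _ [x <-] [y <-]; exists ⁅x, y⁆; rewrite fm.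
Qed.

Lemma bxm_compA (K : fieldType) (X Y Z T : braidedCrossedModule K)
    (h : bxmHom Z T) (g : bxmHom Y Z) (f : bxmHom X Y) :
  bxm_comp h (bxm_comp g f) = bxm_comp (bxm_comp h g) f.
Proof. exact: bxmHom_ext. Qed.

Lemma bxm_comp1 (K : fieldType) (X Y : braidedCrossedModule K)
    (f : bxmHom X Y) : bxm_comp f (bxm_id X) = f.
Proof. exact: bxmHom_ext. Qed.

Section ExtensionsOfX.
Variables (K : fieldType) (X : braidedCrossedModule K).

Lemma gNN_ext (V : lmodType K) (f g : tensNN X -> V) :
  linear f -> linear g -> (forall n n', f (gNN n n') = g (gNN n n')) -> f =1 g.
Proof. exact: tensor_ext. Qed.

Lemma gNM_ext (V : lmodType K) (f g : tensNM X -> V) :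
  linear f -> linear g -> (forall n m, f (gNM n m) = g (gNM n m)) -> f =1 g.
Proof. exact: tensor_ext. Qed.

Section Mediating.
Variables (Z : braidedCrossedModule K) (f : bxmHom Z X).

Lemma Phi_mediating : central_extension f ->
  exists h : bxmHom (Ubxm X) Z, Phi X = bxm_comp f h.
Proof.
move=> [[_ f2s] _ f2k]; have [_ f2m] := hom2_lie f.
have [h1 h1_hom h1E] : exists2 h1 : tensNN X -> xtop Z, lie_hom h1 &
    forall q q', h1 (gNN (hom2 f q) (hom2 f q')) = xbr Z q q'.
  apply: (tensor_factor (alpha := adjoint (xbase X)) (beta := adjoint (xbase X))
    (xbr_tensor_compat Z) (hom2_lie f) (hom2_lie f) f2s f2s f2m _ _ _)
    => [x y|x y /f2k/(_ y)[]//|x y /f2k/(_ x)[]//].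
  exact: f2m.
pose h2 x := xbd (h1 x).
have h2_hom : lie_hom h2 := lie_hom_comp (xbd_hom Z) h1_hom.
have h_act x y : h1 ⁅x, y⁆ = xact Z (h2 x) (h1 y).
  by rewrite xpeiffer h1_hom.2.
have h_br x y : h1 ⁅x, y⁆ = xbr Z (h2 x) (h2 y).
  by rewrite br_bdbd h1_hom.2.
exists (@BxmHom K (Ubxm X) Z h1 h2 h1_hom h2_hom h_act (fun _ => erefl) h_br).
have Phi1E x : Phi1 x = hom1 f (h1 x).
  apply: (gNN_ext (Phi1_hom X).1 (lie_hom_comp (hom1_lie f) h1_hom).1) => n n'.
  have [q <-] := f2s n; have [q' <-] := f2s n'.
  by rewrite Phi1_gen /= h1E hom_br.
by apply: bxmHom_ext => x //=; rewrite -hom_bd -Phi1E xbd_Phi1.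
Qed.

Lemma Phi_mediating_unique (h h' : bxmHom (Ubxm X) Z) :
  surj (@lieNN K X) ->
  (forall n, hom2 f n = 0 -> xbr_center n) ->
  Phi X = bxm_comp f h -> Phi X = bxm_comp f h' -> h = h'.
Proof.
move=> lieNN_surj f2k hE h'E; have zb := br_bilin (xbr Z).
have fh x : hom2 f (hom2 h x - hom2 h' x) = 0.
  rewrite (linB (hom2_lie f).1).
  have := congr1 (fun k : bxmHom (Ubxm X) X => hom2 k x) hE.
  rewrite h'E /= => ->.
  by rewrite subrr.
have e1 : hom1 h =1 hom1 h'.
  apply: (gNN_ext (hom1_lie h).1 (hom1_lie h').1) => n n'.
  have [x <-] := lieNN_surj n; have [y <-] := lieNN_surj n'.
  rewrite -tensNN_lie (hom_br h x y) (hom_br h' x y); apply/eqP.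
  rewrite -subr_eq0 -[X in X - _](subrK (xbr Z (hom2 h' x) (hom2 h y))).
  rewrite -(bilinBl zb) -addrA -(bilinBr zb).
  by rewrite (f2k _ (fh x) _).1 (f2k _ (fh y) _).2 add0r.
by apply: bxmHom_ext => // x; rewrite -[x]/(@xbd _ (Ubxm X) x) -!hom_bd e1.
Qed.

Lemma cV_mediating : compatible_central_extension f ->
  exists h : bxmHom (Vbxm X) Z, cV X = bxm_comp f h.
Proof.
move=> [[f1s f2s] f1k f2k]; have [_ f2m] := hom2_lie f.
have [h1 h1_hom h1E] : exists2 h1 : tensNM X -> xtop Z, lie_hom h1 &
    forall q p, h1 (gNM (hom2 f q) (hom1 f p)) = xact Z q p.
  apply: (tensor_factor (alpha := xact X)
    (beta := act_pullback (adjoint _) (xbd_hom X))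
    (act_tensor_compat Z) (hom2_lie f) (hom1_lie f) f2s f1s (hom_act f) _ _ _)
    => [x y|x y /f2k[/(_ y)]//|x y /f1k/(_ x)//].
  by rewrite /= f2m hom_bd.
have [h2 h2_hom h2E] : exists2 h2 : tensNN X -> xbase Z, lie_hom h2 &
    forall q q', h2 (gNN (hom2 f q) (hom2 f q')) = ⁅q, q'⁆.
  apply: (tensor_factor (alpha := adjoint (xbase X)) (beta := adjoint (xbase X))
    (lie_tensor_compat Z) (hom2_lie f) (hom2_lie f) f2s f2s f2m _ _ _)
    => [x y|x y /f2k[_ /(_ y)]//|x y /f2k[_ /(_ x) e]].
    exact: f2m.
  by rewrite lie_anti e oppr0.
have c1E y : c1 y = hom1 f (h1 y).
  apply: (gNM_ext (c1_hom X).1 (lie_hom_comp (hom1_lie f) h1_hom).1) => n m.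
  have [q <-] := f2s n; have [p <-] := f1s m.
  by rewrite c1_gen /= h1E hom_act.
have lieNNE x : lieNN x = hom2 f (h2 x).
  apply: (gNN_ext (lieNN_hom X).1 (lie_hom_comp (hom2_lie f) h2_hom).1) => n n'.
  have [q <-] := f2s n; have [q' <-] := f2s n'.
  by rewrite lieNN_gen /= h2E f2m.
have h_act x y : h1 (V_act X x y) = xact Z (h2 x) (h1 y).
  by rewrite /= /V_act_fun lieNNE c1E h1E.
have h_bd y : xbd (h1 y) = h2 (id_tens_bd y).
  apply: (gNM_ext (lie_hom_comp (xbd_hom Z) h1_hom).1
    (lie_hom_comp h2_hom (id_tens_bd_hom X)).1) => n m.
  have [q <-] := f2s n; have [p <-] := f1s m.
  by rewrite /= id_tens_bd_gen hom_bd h2E h1E xbd_act.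
have h_br x y : h1 (V_br_fun x y) = xbr Z (h2 x) (h2 y).
  apply: (gNN_ext (linear_comp h1_hom.1 ((V_br_bilin X).2 x))
    (linear_comp ((br_bilin (xbr Z)).2 _) h2_hom.1)) => n n'.
  have [q <-] := f2s n; have [q' <-] := f2s n'.
  by rewrite /V_br_fun Phi1_gen lieNNE -hom_br h1E h2E -(br_bd (xbr Z)) br_bdr.
exists (@BxmHom K (Vbxm X) Z h1 h2 h1_hom h2_hom h_act h_bd h_br).
exact: bxmHom_ext.
Qed.

Lemma cV_mediating_unique (h h' : bxmHom (Vbxm X) Z) :
  surj (@lieNN K X) ->
  surj (@c1 K X) ->
  (forall m, hom1 f m = 0 -> xinvariant m) ->
  (forall n, hom2 f n = 0 -> xstabilizer n /\ lie_center n) ->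
  cV X = bxm_comp f h -> cV X = bxm_comp f h' -> h = h'.
Proof.
move=> lieNN_surj c1_surj f1k f2k hE h'E.
have fh1 y : hom1 f (hom1 h y - hom1 h' y) = 0.
  rewrite (linB (hom1_lie f).1).
  have := congr1 (fun k : bxmHom (Vbxm X) X => hom1 k y) hE.
  by rewrite h'E /= => ->; rewrite subrr.
have fh2 x : hom2 f (hom2 h x - hom2 h' x) = 0.
  rewrite (linB (hom2_lie f).1).
  have := congr1 (fun k : bxmHom (Vbxm X) X => hom2 k x) hE.
  by rewrite h'E /= => ->; rewrite subrr.
apply: bxmHom_ext.
  apply: (gNM_ext (hom1_lie h).1 (hom1_lie h').1) => n m.
  have [x <-] := lieNN_surj n; have [y <-] := c1_surj m.
  rewrite (hom_act h x y) (hom_act h' x y); apply/eqP.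
  have zb := act_bilin (xact Z).
  rewrite -subr_eq0 -[X in X - _](subrK (xact Z (hom2 h' x) (hom1 h y))).
  rewrite -(bilinBl zb) -addrA -(bilinBr zb).
  by rewrite (f2k _ (fh2 x)).1 (f1k _ (fh1 y)) add0r.
apply: (gNN_ext (hom2_lie h).1 (hom2_lie h').1) => n n'.
have [x <-] := lieNN_surj n; have [y <-] := lieNN_surj n'.
rewrite -tensNN_lie (hom2_lie h).2 (hom2_lie h').2; apply/eqP.
have zb := @lie_bilin K (xbase Z).
rewrite -subr_eq0 -[X in X - _](subrK ⁅hom2 h' x, hom2 h y⁆).
rewrite -(bilinBl zb) -addrA -(bilinBr zb) (f2k _ (fh2 x)).2 add0r.
by rewrite lie_anti (f2k _ (fh2 y)).2 oppr0.
Qed.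

End Mediating.

Hypothesis X_perfect : bxm_perfect X.

Lemma Phi1_surj : surj (@Phi1 K X).
Proof.
move=> m; apply: (X_perfect.1 m (fun m => exists x, Phi1 x = m)).
  exact: lie_hom_image_subalgebra (Phi1_hom X).
by move=> _ [n [n' ->]]; exists (gNN n n'); rewrite Phi1_gen.
Qed.

Lemma lieNN_surj : surj (@lieNN K X).
Proof.
have [S0 SL _] := lie_hom_image_subalgebra (lieNN_hom X).
move=> n; apply: (X_perfect.2 n (fun n => exists x, lieNN x = n)) => //.
by move=> a b; exists (gNN a b); rewrite lieNN_gen.
Qed.

Lemma xbd_surj : surj (@xbd K X).
Proof.
by move=> n; have [x <-] := lieNN_surj n; exists (Phi1 x); rewrite xbd_Phi1.
Qed.

Lemma id_tens_bd_surj : surj (@id_tens_bd K X).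
Proof.
have [S0 SL _] := lie_hom_image_subalgebra (id_tens_bd_hom X).
apply: tensor_span => // a b; have [m <-] := xbd_surj b.
by exists (gNM a m); rewrite id_tens_bd_gen.
Qed.

Lemma c1_surj : surj (@c1 K X).
Proof.
move=> m; have [x <-] := Phi1_surj m; have [y <-] := id_tens_bd_surj x.
by exists y; rewrite Phi1_id_tens_bd.
Qed.

Lemma gNM_xbd0 n (m : xtop X) : xbd m = 0 -> gNM n m = 0.
Proof.
move=> m0; have act0 b : xact X b m = 0.
  have [k <-] := xbd_surj b; rewrite xpeiffer lie_anti -xpeiffer m0.
  by rewrite (bilin0l (act_bilin _)) oppr0.
have gl : linear (fun n => gNM n m) := (gNM_bilin X).1 m.
apply: (X_perfect.2 n (fun n => gNM n m = 0)) => [|k y z y0 z0|a b].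
- exact: lin0 gl.
- by rewrite gl y0 z0 scaler0 addr0.
by rewrite gNM_liel !act0 !(bilin0r (gNM_bilin X)) subrr.
Qed.

Lemma Phi_central : central_extension (Phi X).
Proof.
split; first by split=> [m|n]; [exact: Phi1_surj | exact: lieNN_surj].
  move=> x x0 n; rewrite [LHS](tensNN_lie n x) -(xbd_Phi1 x) [Phi1 x]x0.
  by rewrite (lin0 (xbd_hom X).1) (bilin0r (gNN_bilin X)).
move=> x /= x0 y; split; rewrite [LHS]tensNN_lie x0.
  by rewrite (bilin0l (gNN_bilin X)).
by rewrite (bilin0r (gNN_bilin X)).
Qed.

Lemma Phi_compatible : compatible_central_extension (Phi X).
Proof.
by have [e k1 k2] := Phi_central; split=> // x /k2 x0; split=> y;
  case: (x0 y).
Qed.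

Lemma cV_compatible : compatible_central_extension (cV X).
Proof.
split; first by split=> [m|n]; [exact: c1_surj | exact: lieNN_surj].
  by move=> y /= y0 x; rewrite /= /V_act_fun y0 (bilin0r (gNM_bilin X)).
move=> x /= x0; split=> y /=.
  by rewrite /V_act_fun x0 (bilin0l (gNM_bilin X)).
by rewrite tensNN_lie x0 (bilin0l (gNN_bilin X)).
Qed.

Lemma cV_central : central_extension (cV X).
Proof.
have [e k1 _] := cV_compatible; split=> // x /= x0 y.
split; first by rewrite /= /V_br_fun x0 (bilin0l (gNM_bilin X)).
by apply: gNM_xbd0; rewrite xbd_Phi1.
Qed.

Lemma Phi_universal : universal_central_extension (Phi X).
Proof.
split=> [|Z f fc]; first exact: Phi_central.
have [h hE] := Phi_mediating fc; exists h; split=> // h' h'E.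
by case: fc => _ _ f2k; exact: (Phi_mediating_unique lieNN_surj f2k hE h'E).
Qed.

Lemma cV_universal : universal_compatible_central_extension (cV X).
Proof.
split=> [|Z f fc]; first exact: cV_compatible.
have [h hE] := cV_mediating fc; exists h; split=> // h' h'E.
case: fc => _ f1k f2k.
exact: (cV_mediating_unique lieNN_surj c1_surj f1k f2k hE h'E).
Qed.

End ExtensionsOfX.

Theorem proposition4p3 (K : fieldType) (X : braidedCrossedModule K) :
  bxm_perfect X ->
  [/\ universal_central_extension (Phi X),
      universal_compatible_central_extension (cV X)
    & exists h : bxmHom (Ubxm X) (Vbxm X),
        unique (fun h' : bxmHom (Ubxm X) (Vbxm X) =>
                  Phi X = bxm_comp (cV X) h') h
        /\ bxm_iso h].
Proof.
move=> Xp; have Pu := Phi_universal Xp; have cu := cV_universal Xp.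
split=> //; have [h [hE h_uniq]] := Pu.2 _ _ (cV_central Xp).
exists h; split=> //.
have [k [kE _]] := cu.2 _ _ (Phi_compatible Xp).
exists k; split.
  have [i [_ i_uniq]] := Pu.2 _ _ (Phi_central Xp).
  by rewrite -(i_uniq (bxm_id _)) ?bxm_comp1// -(i_uniq (bxm_comp k h))//
    bxm_compA -kE.
have [i [_ i_uniq]] := cu.2 _ _ (cV_compatible Xp).
by rewrite -(i_uniq (bxm_id _)) ?bxm_comp1// -(i_uniq (bxm_comp h k))//
  bxm_compA -hE.
Qed.
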